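(* For every integer $n\ge 0$, \[ \overline{p}_o(n)+2\sum_{k=1}^{\infty}(-1)^k\,\overline{p}_o(n-2k^2)=\begin{cases}2, & \text{if } n=m^2 \text{ for some integer } m\ge 1,\\ 1, & \text{if } n=0,\\ 0, & \text{otherwise}.\end{cases} \]
   Context: An overpartition of a nonnegative integer $n$ is a partition of $n$ in which the first occurrence of each part size may be overlined. $\overline{p}_o(n)$ denotes the number of overpartitions of $n$ into odd parts; equivalently $\sum_{n\ge0}\overline{p}_o(n)q^n=\frac{(-q;q^2)_\infty}{(q;q^2)_\infty}$, where $(a;q)_\infty=\prod_{k\ge1}(1-aq^{k-1})$. Convention: $\overline{p}_o(x)=0$ whenever $x$ is not a nonnegative integer. *)

(* Defs.v *)
From mathcomp Require Import all_boot all_order all_algebra.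
From mathcomp Require Import zify.

Set Implicit Arguments.
Unset Strict Implicit.
Unset Printing Implicit Defensive.

(* An overpartition is the weakly decreasing list of its parts, each tagged
   with a boolean telling whether that part is overlined. *)
Definition opart := (nat * bool)%type.

(* [opart_step x y]: y may come right after x.  As the list is decreasing, a
   part that is not the first occurrence of its size directly follows a part of
   the same size, and so must not be overlined. *)
Definition opart_step (x y : opart) : bool :=
  (y.1 < x.1) || (y.1 == x.1) && ~~ y.2.

Definition is_overpartition (n : nat) (s : seq opart) : bool :=
  [&& all (fun x => 0 < x.1) s, sorted opart_step s & sumn (unzip1 s) == n].

Definition odd_overpartition (n : nat) (s : seq opart) : bool :=
  is_overpartition n s && all (fun x => odd x.1) s.

Definition opart_of_ord n (x : 'I_n.+1 * bool) : opart := (x.1 : nat, x.2).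

(* The number of overpartitions of n into odd parts.  By [overpartition_bound]
   there are at most n parts, each at most n, so counting tuples of length at
   most n over 'I_n.+1 misses none. *)
Definition pbar_o_nat (n : nat) : nat :=
  \sum_(l < n.+1)
    #|[set t : l.-tuple ('I_n.+1 * bool)
         | odd_overpartition n [seq opart_of_ord x | x <- t]]|.

Lemma overpartition_bound n s :
  is_overpartition n s -> size s <= n /\ all (fun x => x.1 <= n) s.
Proof.
case/and3P=> pos_s _ /eqP <-; elim: s pos_s => [|x s IHs] //= /andP[x_gt0].
case/IHs=> sz_s le_s; split; first by lia.
rewrite leq_addr /=; apply: sub_all le_s => y /= le_y.
exact: leq_trans le_y (leq_addl _ _).
Qed.

Definition pbar_o (x : int) : int :=
  match x with
  | Posz n => Posz (pbar_o_nat n)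
  | Negz _ => Posz 0
  end.

(* Main.v *)
(* Write P for the generating function of overpartitions into odd parts and
   A = (q;q^2), B = (-q;q^2), so that A P = B.  Jacobi's triple product gives
   1 + 2 sum_k (-1)^k q^(2k^2) = (AB)^2 (q^4;q^4) and
   1 + 2 sum_k q^(k^2) = B^2 (q^2;q^2), and AB (q^4;q^4) = (q^2;q^2); hence P
   times the first theta series is the second one, which is the claim
   coefficientwise.  Power series are replaced by polynomials modulo X^M, and the
   triple product by its finite form, a case of the q-binomial theorem. *)
Require Import Defs.
From mathcomp Require Import all_boot all_order all_algebra.
From mathcomp Require Import boolp classical_sets fsbigop.
From mathcomp Require Import zify ring.

Set Implicit Arguments.
Unset Strict Implicit.
Unset Printing Implicit Defensive.

(** * Recursive enumeration of the overpartitions into odd parts *)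

(* The lists of F n, preceded by any number of non-overlined parts j; k is fuel,
   enough as soon as n <= k. *)
Fixpoint prepend_part (j : nat) (F : nat -> seq (seq opart)) (k n : nat) :=
  F n ++ (if k is k'.+1 then
            if j <= n then [seq (j, false) :: s | s <- prepend_part j F k' (n - j)]
            else [::]
          else [::]).

(* The parts are bounded by 2m, not by m. *)
Fixpoint odd_ovps (m n : nat) : seq (seq opart) :=
  if m is m'.+1 then
    odd_ovps m' n ++
    (if m'.*2.+1 <= n then
       let t := prepend_part m'.*2.+1 (odd_ovps m') n (n - m'.*2.+1) in
       [seq (m'.*2.+1, false) :: s | s <- t] ++ [seq (m'.*2.+1, true) :: s | s <- t]
     else [::])
  else if n == 0 then [:: [::]] else [::].

Lemma odd_overpartitionE n s :
  odd_overpartition n s =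
  [&& sorted opart_step s, sumn (unzip1 s) == n & all (fun x => odd x.1) s].
Proof.
rewrite /odd_overpartition /is_overpartition.
case Eo: (all (fun x : opart => odd x.1) s); rewrite ?andbF ?andbT //.
have -> // : all (fun x : opart => 0 < x.1) s.
by apply: sub_all Eo => x; exact: odd_gt0.
Qed.

Lemma opart_step_path_bound x s :
  path opart_step x s -> all (fun y => y.1 <= x.1) s.
Proof.
elim: s x => //= y s IHs x /andP[st /IHs al].
have le : y.1 <= x.1 by case/orP: st => [/ltnW|/andP[/eqP-> _]].
by rewrite le; apply: sub_all al => z /= h; exact: leq_trans h le.
Qed.

Lemma all_lt_head B x s : path opart_step x s ->
  (x.1 < B) && all (fun y => y.1 < B) s = (x.1 < B).
Proof.
move/opart_step_path_bound => Eb; case: ltnP => //= lt_x.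
by apply: sub_all Eb => y /= /leq_ltn_trans; apply.
Qed.

Lemma mem_map_cons (T : eqType) (x y : T) (s : seq T) (L : seq (seq T)) :
  (y :: s \in [seq x :: t | t <- L]) = (y == x) && (s \in L).
Proof.
apply/mapP/andP => [[t tL [-> ->]]|[/eqP-> sL]]; first by rewrite eqxx.
by exists s.
Qed.

Lemma nil_map_cons (T : eqType) (x : T) (L : seq (seq T)) :
  ([::] \in [seq x :: t | t <- L]) = false.
Proof. by apply/negP => /mapP[]. Qed.

Section Extension.

Variables (m : nat) (F : nat -> seq (seq opart)).
Hypothesis memF : forall n s,
  (s \in F n) = odd_overpartition n s && all (fun x => x.1 < m.*2) s.

Let j := m.*2.+1.

(** What may follow a part [j] either starts with a plain [j] or has only smaller parts, as in the
    recursion. The flag [b] is free because [opart_step] reads only the size of its first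
    argument. *)
Lemma mem_prepend_part b k n s : n <= k ->
  (s \in prepend_part j F k n) =
  [&& path opart_step (j, b) s, sumn (unzip1 s) == n & all (fun x => odd x.1) s].
Proof.
elim: k n s b => [|k IHk] n s b le_nk.
  move: le_nk; rewrite leqn0 => /eqP->; rewrite /= cats0 memF odd_overpartitionE.
  case: s => [|[a c] s] //=; case Eo: (odd a); last by rewrite !(andbF,andFb).
  have -> : (a + sumn (unzip1 s) == 0) = false by lia.
  by rewrite !(andbF, andFb).
rewrite /= mem_cat memF odd_overpartitionE; case: s => [|[a c] s] /=.
  by case: ifP; rewrite ?nil_map_cons ?in_nil !(orbF, andbT).
have -> : ((a, c) :: s \in (if j <= n then
    [seq (j, false) :: s | s <- prepend_part j F k (n - j)] else [::])) =
   [&& a == j, ~~ c, path opart_step (a, c) s, a + sumn (unzip1 s) == n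
     & all (fun x => odd x.1) s].
  case: ifP => le_jn.
    rewrite mem_map_cons (IHk _ _ c); last by rewrite /j in le_jn *; lia.
    rewrite xpair_eqE; case: (eqVneq a j) => //= ->; case: c => //=.
    by congr (_ && (_ && _)); lia.
  rewrite in_nil; case: (eqVneq a j) => //= ->.
  have -> : (j + sumn (unzip1 s) == n) = false by lia.
  by rewrite andbF /= andbF.
rewrite /opart_step /=.
case Ep: (path _ _ s); rewrite ?(andbF, andFb) //=.
case Es: (a + _ == n); rewrite ?(andbF, andFb) //=.
case Eo: (odd a); rewrite ?(andbF, andFb) //=; last first.
  by case: (eqVneq a j) Eo => // ->; rewrite /j /= odd_double.
case Et: (all _ s); rewrite ?(andbF, andFb) //=.
rewrite !andbT; congr (_ || _).
(* Here [a] is odd, so it cannot equal [m.*2]. *)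
have -> : (a < j) = (a < m.*2).
  by rewrite /j; apply/idP/idP; lia.
by have /= -> := all_lt_head m.*2 Ep.
Qed.

Lemma notin_extension n L b : 
  ~~ has (mem (F n)) [seq (j, b) :: s | s <- L].
Proof.
apply/hasPn => _ /mapP[s _ ->] /=; rewrite memF /= /j.
have -> : (m.*2.+1 < m.*2) = false by lia.
by rewrite andbF.
Qed.

Hypothesis uniqF : forall n, uniq (F n).

Lemma uniq_prepend_part k n : uniq (prepend_part j F k n).
Proof.
elim: k n => [|k IHk] n /=; first by rewrite cats0.
rewrite cat_uniq uniqF /=; case: ifP => // _.
by rewrite notin_extension map_inj_uniq ?IHk // => ? ? [].
Qed.

End Extension.

Lemma mem_odd_ovps m n s :
  (s \in odd_ovps m n) = odd_overpartition n s && all (fun x => x.1 < m.*2) s.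
Proof.
elim: m n s => [|m IHm] n s.
  rewrite odd_overpartitionE /=; case: s => [|[a c] s] /=; last first.
    by rewrite !andbF; case: ifP; rewrite // inE.
  by case: n.
rewrite /= mem_cat IHm.
set T := prepend_part _ _ _ _.
case: s => [|[a c] s].
  rewrite odd_overpartitionE /=.
  by case: ifP; rewrite ?mem_cat ?nil_map_cons ?in_nil !(orbF, andbT).
have -> : ((a, c) :: s \in (if m.*2 < n then [seq (m.*2.+1, false) :: s | s <- T]
       ++ [seq (m.*2.+1, true) :: s | s <- T] else [::])) =
   (a == m.*2.+1) && odd_overpartition n ((a, c) :: s).
  rewrite odd_overpartitionE; case: ifP => le_jn.
    rewrite mem_cat !mem_map_cons !xpair_eqE /T.
    rewrite (mem_prepend_part IHm c); last by lia.
    case: (eqVneq a _) => //= ->.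
    have -> : (m.*2.+1 + sumn (unzip1 s) == n) =
              (sumn (unzip1 s) == n - m.*2.+1) by lia.
    by case: c; rewrite /= ?orbF odd_double.
  rewrite in_nil; case: (eqVneq a _) => //= ->.
  have -> : (m.*2.+1 + sumn (unzip1 s) == n) = false by lia.
  by rewrite andbF.
case Eov: odd_overpartition; rewrite ?andbF //= andbT.
move: Eov; rewrite odd_overpartitionE /= => /and3P[Ep _ /andP[Eo _]].
have /= -> := all_lt_head m.*2 Ep.
have /= -> := all_lt_head m.+1.*2 Ep.
apply/idP/idP; lia.
Qed.

Lemma uniq_odd_ovps m n : uniq (odd_ovps m n).
Proof.
elim: m n => [|m IHm] n /=; first by case: ifP.
case: ifP => _; last by rewrite cats0.
have memF := mem_odd_ovps m.
rewrite cat_uniq IHm /= has_cat !(negbTE (notin_extension memF _ _ _)) /=.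
rewrite cat_uniq !map_inj_uniq ?uniq_prepend_part //; try by move=> ? ? [].
rewrite andbT /=; apply/hasPn => _ /mapP[s _ ->]; rewrite /= mem_map_cons.
by rewrite xpair_eqE andbF.
Qed.

(** No part exceeds [n], so [n < m.*2] makes the bound on the parts in [odd_ovps m n] automatic.
    Both counts are then split by length; at each length [g] is a bijection from tuples to lists,
    inverted through [h]. *)
Lemma pbar_o_natE m n : n < m.*2 -> pbar_o_nat n = size (odd_ovps m n).
Proof.
move=> lt_nm; set L := odd_ovps m n.
have memL s : (s \in L) = odd_overpartition n s.
  rewrite mem_odd_ovps; case Eo: odd_overpartition => //=.
  case/andP: Eo => /overpartition_bound[_ al] _.
  by apply: sub_all al => x /= /leq_ltn_trans; apply.
have -> : size L = \sum_(l < n.+1) count (fun s => size s == l) L.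
  rewrite -sum1_size; under [RHS]eq_bigr do rewrite -sum1_count big_mkcond /=.
  rewrite exchange_big /= !big_seq; apply: eq_bigr => s.
  rewrite memL => /andP[/overpartition_bound[sz _] _].
  rewrite -big_mkcond /= (big_pred1 (Ordinal (sz : size s < n.+1))) //.
apply: eq_bigr => l _; rewrite cardE -size_filter.
pose g (t : l.-tuple ('I_n.+1 * bool)) := [seq opart_of_ord x | x <- t].
have inj_f : injective (@opart_of_ord n).
  by move=> [x b] [y c] [/val_inj -> ->].
have inj_g : injective g by move=> t u /(inj_map inj_f)/val_inj.
rewrite -(size_map g); apply/perm_size/uniq_perm.
- by rewrite map_inj_uniq ?enum_uniq.
- by rewrite filter_uniq ?uniq_odd_ovps.
move=> s; rewrite mem_filter memL; apply/mapP/andP => [[t]|[/eqP sz_s ov_s]].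
  by rewrite mem_enum inE => ov_t ->; rewrite size_map size_tuple eqxx.
have [_ al] := overpartition_bound (proj1 (andP ov_s)).
pose h (x : opart) : 'I_n.+1 * bool := (inord x.1, x.2).
have sz_t : size (map h s) == l by rewrite size_map sz_s.
have gE : g (Tuple sz_t) = s.
  rewrite /g /= -map_comp -[RHS]map_id; apply/eq_in_map => -[a b] /(allP al) /=.
  by move=> le_a; rewrite /opart_of_ord /= inordK.
by exists (Tuple sz_t); rewrite ?mem_enum ?inE // -/(g _) gE.
Qed.

(** * Recurrence for the number of enumerated lists *)

Lemma prepend_part_fuel j F k l n : 0 < j -> n <= k -> n <= l ->
  prepend_part j F k n = prepend_part j F l n.
Proof.
move=> j_gt0; elim: k l n => [|k IHk] [|l] n //=.
- by rewrite leqn0 => /eqP-> _; rewrite leqNgt j_gt0.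
- by rewrite leqn0 => _ /eqP->; rewrite leqNgt j_gt0.
by move=> le_nk le_nl; congr (_ ++ _); case: ifP => // le_jn;
   rewrite (IHk l) //; lia.
Qed.

(** Coefficient form of [(1 - q^j) P_(m+1) = (1 + q^j) P_m], where [j = 2m+1] and [P_m] is the
    generating function of the sizes of [odd_ovps m]. If [a] counts [odd_ovps m] and [t] counts
    [prepend_part], the left side is [a(n) + 2t(r)] with [r = n - j], and [t(r) = a(r) + t(r-j)]
    turns [2t(r)] into [a(r) + (a(r) + 2t(r-j))]. *)
Lemma size_odd_ovpsS m n :
  size (odd_ovps m.+1 n) = size (odd_ovps m n) +
    (if m.*2 < n then
       size (odd_ovps m (n - m.*2.+1)) + size (odd_ovps m.+1 (n - m.*2.+1))
     else 0).
Proof.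
rewrite /= !size_cat; case: ifP => //= lt_mn; rewrite !size_cat !size_map.
set j := m.*2.+1; set r := n - j.
(* Fuel of successor form lets [prepend_part] unfold once. *)
have -> : prepend_part j (odd_ovps m) n r = prepend_part j (odd_ovps m) r.+1 r.
  by apply: prepend_part_fuel; rewrite /r /j; lia.
rewrite /= size_cat; case: ifP => le_jr; last by rewrite /= !addn0.
rewrite size_cat !size_map.
have -> : prepend_part j (odd_ovps m) r (r - j) =
          prepend_part j (odd_ovps m) r.+1 (r - j).
  by apply: prepend_part_fuel; rewrite /r /j; lia.
by rewrite /r; set u := size _; set v := size _; set w := size _; lia.
Qed.

Import GRing.Theory.
Local Open Scope ring_scope.

(** * Gaussian binomials and the q-binomial theorem *)

Section QBinomial.

Variables (R : comNzRingType) (x : R).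

(** The q-Pochhammer symbol [(x; x)_n]. *)
Definition qpoch n : R := \prod_(i < n) (1 - x ^+ i.+1).

Lemma qpochS n : qpoch n.+1 = qpoch n * (1 - x ^+ n.+1).
Proof. by rewrite /qpoch big_ord_recr. Qed.

(* This form of the Pascal rule matches the expansion of the last factor of
   the product in [qbinomial_theorem]. *)
Fixpoint qbinom n k : R :=
  match n, k with
  | _, 0 => 1
  | 0, _.+1 => 0
  | n'.+1, k'.+1 => qbinom n' k'.+1 + x ^+ (n' - k') * qbinom n' k'
  end.

Lemma qbinom0 n : qbinom n 0 = 1. Proof. by case: n. Qed.

Lemma qbinomS n k :
  qbinom n.+1 k.+1 = qbinom n k.+1 + x ^+ (n - k) * qbinom n k.
Proof. by []. Qed.

Lemma qbinom_small n k : (n < k)%N -> qbinom n k = 0.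
Proof.
elim: n k => [|n IHn] [|k] // lt_nk; rewrite qbinomS !IHn //; last by lia.
by rewrite mulr0 addr0.
Qed.

(** The quotient formula without division. The two Pascal terms contribute [1 - x^(n-k)] and
    [x^(n-k) - x^(n+1)] times [qpoch n]. *)
Lemma qbinom_qpoch n k : (k <= n)%N ->
  qbinom n k * (qpoch k * qpoch (n - k)) = qpoch n.
Proof.
elim: n k => [|n IHn] [|k] // le_kn.
- by rewrite /= /qpoch !big_ord0 !mul1r.
- by rewrite qbinom0 subn0 mul1r /qpoch big_ord0 mul1r.
rewrite qbinomS subSS mulrDl.
have IH2 := IHn k le_kn.
have -> : x ^+ (n - k) * qbinom n k * (qpoch k.+1 * qpoch (n - k)) =
   x ^+ (n - k) * (1 - x ^+ k.+1) * qpoch n.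
  by rewrite -IH2 qpochS; ring.
have -> : qbinom n k.+1 * (qpoch k.+1 * qpoch (n - k)) =
          (1 - x ^+ (n - k)) * qpoch n.
  case: (ltnP k n) => lt_kn; last first.
    have -> : (n - k = 0)%N by lia.
    by rewrite qbinom_small // expr0 subrr !mul0r.
  rewrite -(IHn k.+1) //.
  have -> : (n - k = (n - k.+1).+1)%N by lia.
  by rewrite [qpoch (n - k.+1).+1]qpochS; ring.
have -> : x ^+ (n - k) * (1 - x ^+ k.+1) = x ^+ (n - k) - x ^+ n.+1.
  by rewrite mulrBr mulr1 -exprD; congr (_ - x ^+ _); lia.
by rewrite qpochS; ring.
Qed.

(** Keeping both [a] and [b] avoids negative powers of [y] when the triple product is derived. *)
Lemma qbinomial_theorem n (a b : R) :
  \prod_(i < n) (a + b * x ^+ i) =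
  \sum_(k < n.+1) x ^+ 'C(k, 2) * qbinom n k * b ^+ k * a ^+ (n - k).
Proof.
elim: n => [|n IHn].
  by rewrite big_ord0 big_ord1 /= !mulr1.
rewrite big_ord_recr /= IHn [RHS]big_ord_recl /= subn0 !mulr1 ?mul1r.
under [X in _ = _ + X]eq_bigr => k _.
  have -> : x ^+ 'C(bump 0 k, 2) * qbinom n.+1 (bump 0 k) * b ^+ (bump 0 k)
     * a ^+ (n.+1 - bump 0 k) =
     x ^+ 'C(k.+1, 2) * qbinom n k.+1 * b ^+ k.+1 * a ^+ (n - k)
     + b * x ^+ n * (x ^+ 'C(k, 2) * qbinom n k * b ^+ k * a ^+ (n - k)).
    rewrite /bump add1n subSS qbinomS binS bin1 addnC !exprD.
    have -> : x ^+ n = x ^+ k * x ^+ (n - k).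
      by rewrite -exprD subnKC // -ltnS.
    by rewrite exprS; ring.
  over.
rewrite big_split /= -mulr_sumr mulrDr addrA [X in _ + X]mulrC; congr (_ + _).
rewrite [X in _ = _ + X]big_ord_recr /= qbinom_small // mulr0 !mul0r addr0.
rewrite mulr_suml big_ord_recl /= qbinom0 subn0 !mulr1 mul1r -exprSr.
congr (_ + _); apply: eq_bigr => k _; rewrite /bump add1n.
have -> : (n - k = (n - k.+1).+1)%N by case: k => k /=; lia.
by rewrite [a ^+ _.+1]exprSr; ring.
Qed.

End QBinomial.

(** * Finite form of Jacobi's triple product *)

(** For [N > 0], apply the q-binomial theorem to [2N] factors with [x = y^2], [a = y^(2N-1)],
    [b = s]. Since [s^2 = 1], each half of the factors is the same product up to a monomial, the
    first half in reverse order. Cancelling the monomial centres the sum at [k = N]; the truncated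
    subtractions encode the distance of [k] from [N]. *)
Lemma finite_jacobi (R : idomainType) (y s : R) N : y != 0 -> s * s = 1 ->
  \prod_(i < N) (1 + s * y ^+ i.*2.+1) ^+ 2 =
  \sum_(k < N.*2.+1)
    s ^+ (k + N) * y ^+ (((k - N) + (N - k)) ^ 2) * qbinom (y ^+ 2) N.*2 k.
Proof.
move=> y_neq0 ss1; case: N => [|N]; first by rewrite big_ord0 big_ord1 /= !mulr1.
have := qbinomial_theorem (y ^+ 2) N.+1.*2 (y ^+ N.*2.+1) s.
set P := \prod_(i < N.+1) (1 + s * y ^+ i.*2.+1).
have -> : \prod_(i < N.+1.*2) (y ^+ N.*2.+1 + s * (y ^+ 2) ^+ i) =
    s ^+ N.+1 * y ^+ (N.+1 * N + N.+1 * N.*2.+1) * P ^+ 2.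
  rewrite -addnn big_split_ord /=.
  have -> : \prod_(i < N.+1) (y ^+ N.*2.+1 + s * (y ^+ 2) ^+ i) =
       s ^+ N.+1 * y ^+ (N.+1 * N) * P.
    transitivity (\prod_(i < N.+1)
        ((s * y ^+ i.*2) * (1 + s * y ^+ (rev_ord i).*2.+1))).
      apply: eq_bigr => i _; rewrite -exprM mul2n mulrDr mulr1 addrC mulrACA ss1.
      rewrite mul1r -exprD; congr (_ + y ^+ _).
      by case: i => i /= lt_i; lia.
    rewrite big_split /= big_split /= prodr_const card_ord; congr (_ * _ * _).
      elim: N {P} => [|N IHN]; first by rewrite big_ord1.
      by rewrite big_ord_recr IHN /= -exprD; congr (_ ^+ _); lia.
    by rewrite /P [RHS](reindex_inj rev_ord_inj).
  have -> : \prod_(i < N.+1) (y ^+ N.*2.+1 + s * (y ^+ 2) ^+ (N.+1 + i)) =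
       y ^+ (N.+1 * N.*2.+1) * P.
    transitivity (\prod_(i < N.+1) (y ^+ N.*2.+1 * (1 + s * y ^+ i.*2.+1))).
      apply: eq_bigr => i _; rewrite -exprM mulrDr mulr1 mulrCA -exprD.
      by congr (_ + s * y ^+ _); lia.
    by rewrite big_split /= prodr_const card_ord -exprM mulnC.
  by rewrite exprD; ring.
move=> E; rewrite prodrXl -/P.
have sN : s ^+ N.+1 * s ^+ N.+1 = 1 by rewrite -exprMn ss1 expr1n.
pose Y := y ^+ (N.+1 * N + N.+1 * N.*2.+1).
have Y0 : Y != 0 by rewrite expf_neq0.
apply: (mulfI Y0); apply: (mulfI (x := s ^+ N.+1)).
  by apply/eqP => s0; move/eqP: sN; rewrite s0 mul0r eq_sym oner_eq0.
rewrite mulrA E !mulr_sumr; apply: eq_bigr => k _.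
rewrite [s ^+ (k + _)]exprD /Y -!exprM.
set Q := qbinom _ _ _.
transitivity (s ^+ k * Q * y ^+ (2 * 'C(k, 2) + N.*2.+1 * (N.+1.*2 - k))).
  by rewrite exprD; ring.
(* Completing the square in [k]. On either side of [N.+1] the distance [d] replaces the truncated
   subtractions. *)
have -> : (2 * 'C(k, 2) + N.*2.+1 * (N.+1.*2 - k) =
  (N.+1 * N + N.+1 * N.*2.+1) + ((k - N.+1) + (N.+1 - k)) ^ 2)%N.
  have -> : (2 * 'C(k, 2) = k * k.-1)%N.
    by rewrite bin2 mul2n halfK oddM; case: (val k) => //= i; rewrite andNb subn0.
  case: k {Q} => [k] /=; rewrite ltnS => le_k.
  case: (leqP k N.+1) => lek.
    have -> : (k - N.+1 = 0)%N by lia.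
    have [d dE] : exists d, (N.+1 = k + d)%N by exists (N.+1 - k)%N; lia.
    have -> : (N.+1 - k = d)%N by lia.
    have -> : (N.+1.*2 - k = k + d + d)%N by lia.
    case: k lek le_k dE => [|k] lek le_k dE /=; nia.
  have [d dE] : exists d, (k = N.+1 + d)%N by exists (k - N.+1)%N; lia.
  have -> : (N.+1 - k = 0)%N by lia.
  have -> : (k - N.+1 = d)%N by lia.
  have -> : (k.-1 = N + d)%N by lia.
  have [c cE] : exists c, (N.+1 = c + d)%N by exists (N.+1 - d)%N; lia.
  have -> : (N.+1.*2 - k = c)%N by lia.
  nia.
by rewrite exprD -[in LHS](mulr1 (s ^+ k)) -sN; ring.
Qed.

(** * Congruence of polynomials modulo a power of X *)

Section ModX.

Variable R : comNzRingType.
Implicit Types p q u v : {poly R}.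

Definition eqmodX M p q := forall i, (i < M)%N -> p`_i = q`_i.

Lemma eqmodX_refl M p : eqmodX M p p. Proof. by []. Qed.

Lemma eqmodX_sym M p q : eqmodX M p q -> eqmodX M q p.
Proof. by move=> h i /h. Qed.

Lemma eqmodX_trans M q p u : eqmodX M p q -> eqmodX M q u -> eqmodX M p u.
Proof. by move=> h g i iM; rewrite h ?g. Qed.

Lemma eqmodX_weaken K M p q : (K <= M)%N -> eqmodX M p q -> eqmodX K p q.
Proof. by move=> le h i iM; apply: h; exact: leq_trans iM le. Qed.

Lemma eqmodXM M p q u v :
  eqmodX M p q -> eqmodX M u v -> eqmodX M (p * u) (q * v).
Proof.
move=> h g i iM; rewrite !coefM; apply: eq_bigr => k _.
by rewrite h ?g //; case: k => k /=; lia.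
Qed.

Lemma eqmodXMl M u p q : eqmodX M p q -> eqmodX M (u * p) (u * q).
Proof. exact: eqmodXM. Qed.

Lemma eqmodXMr M u p q : eqmodX M p q -> eqmodX M (p * u) (q * u).
Proof. by move=> h; apply: eqmodXM. Qed.

Lemma eqmodX_sum M n (F G : 'I_n -> {poly R}) :
  (forall i, eqmodX M (F i) (G i)) -> eqmodX M (\sum_i F i) (\sum_i G i).
Proof. by move=> h i iM; rewrite !coef_sum; apply: eq_bigr => k _; apply: h. Qed.

Lemma eqmodX_XnM M k p q : eqmodX M p q -> eqmodX (k + M) ('X^k * p) ('X^k * q).
Proof.
by move=> h i iM; rewrite !coefXnM; case: ltnP => // le_k; apply: h; lia.
Qed.

(** As [u] has constant term 1, coefficient [i] of [u * p] is [p_i] plus terms in earlier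
    coefficients of [p], so strong induction applies. *)
Lemma eqmodX_mulIl M u p q : u`_0 = 1 -> eqmodX M (u * p) (u * q) -> eqmodX M p q.
Proof.
move=> u0 h i; elim/ltn_ind: i => i IHi iM; move: (h i iM).
rewrite !coefM !big_ord_recl /= subn0 u0 !mul1r.
set S := \sum_(_ < _) _; set T := \sum_(_ < _) _.
have -> : S = T; last by move/addIr.
by apply: eq_bigr => k _; rewrite IHi // /bump; case: k => k /=; lia.
Qed.

(** Each factor beyond the first [a] is 1 modulo [X^((a+1)e)]. *)
Lemma qpoch_eqmodX e a b : (0 < e)%N -> (a <= b)%N ->
  eqmodX (a.+1 * e) (qpoch ('X^e : {poly R}) b) (qpoch 'X^e a).
Proof.
move=> e_gt0 /subnK <-; elim: (b - a)%N => [|d IHd]; first exact: eqmodX_refl.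
rewrite addSn qpochS -[X in eqmodX _ _ X]mulr1; apply: eqmodXM => // i iM.
rewrite -exprM coefB coefXn.
have -> : (i == e * (d + a).+1)%N = false by nia.
by rewrite subr0.
Qed.

Lemma qpoch_coef0 e n : (0 < e)%N -> (qpoch ('X^e : {poly R}) n)`_0 = 1.
Proof.
move=> e_gt0; have := qpoch_eqmodX e_gt0 (leq0n n) => ->; last by lia.
by rewrite /qpoch big_ord0 coef1.
Qed.

(** With [m] the minimum, [qpoch_eqmodX] makes every symbol of index at least [m] congruent to [u].
    After multiplication by [u * u], [qbinom_qpoch] reduces both sides to products of two such
    symbols. *)
Lemma qbinom_eqmodX e N k : (0 < e)%N -> (k <= N.*2)%N ->
  eqmodX ((minn k (N.*2 - k)).+1 * e)
    (qpoch 'X^e N * qbinom ('X^e : {poly R}) N.*2 k) 1.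
Proof.
move=> e_gt0 le_k; set m := minn _ _; pose u := qpoch ('X^e : {poly R}) m.
have E a : (m <= a)%N -> eqmodX (m.+1 * e) (qpoch 'X^e a) u.
  exact: qpoch_eqmodX.
apply: (@eqmodX_mulIl _ (u * u)).
  by rewrite coefM big_ord1 qpoch_coef0 // mulr1.
apply: (@eqmodX_trans _ (qpoch 'X^e N * qpoch 'X^e N.*2)); last first.
  by rewrite mulr1; apply: eqmodXM; apply: E; rewrite /m; lia.
rewrite mulrCA -(qbinom_qpoch 'X^e le_k).
apply: eqmodXMl.
rewrite mulrC; apply: eqmodXMl.
by apply: eqmodX_sym; apply: eqmodXM; apply: E; rewrite /m; lia.
Qed.

End ModX.

(** * Theta series as truncated products *)

Lemma jacobi_eqmodX (R : idomainType) e N (s : {poly R}) :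
  (0 < e)%N -> s * s = 1 ->
  eqmodX N.*2.+1
    (qpoch ('X^e ^+ 2) N * \prod_(i < N) (1 + s * 'X^e ^+ i.*2.+1) ^+ 2)
    (1 + 2 * \sum_(j < N) s ^+ j.+1 * 'X^e ^+ (j.+1 ^ 2)).
Proof.
move=> e_gt0 ss1.
(* The full sum is symmetric about [k = N]: powers of [s] depend only on the parity of the exponent,
   and the central term is 1. *)
have -> : 1 + 2 * \sum_(j < N) s ^+ j.+1 * 'X^e ^+ (j.+1 ^ 2) =
   \sum_(k < N.*2.+1) s ^+ (k + N) * 'X^e ^+ (((k - N) + (N - k)) ^ 2).
  have s2 i j : (odd i = odd j) -> s ^+ i = s ^+ j.
    have sE h : s ^+ h = s ^+ odd h.
      by rewrite -{1}(odd_double_half h) exprD -mul2n exprM expr2 ss1 expr1n mulr1.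
    by move=> oij; rewrite (sE i) (sE j) oij.
  rewrite -addnn -addnS big_split_ord /= [X in _ = _ + X]big_ord_recl /=.
  have -> : (N + 0 - N + (N - (N + 0)) = 0)%N by lia.
  rewrite (@s2 (N + 0 + N)%N 0%N); last by rewrite addn0 addnn odd_double.
  rewrite expr0 mulr1 mulr_natl mulr2n addrCA; congr (_ + (_ + _)).
    rewrite (reindex_inj rev_ord_inj); apply: eq_bigr => i _ /=.
    congr (_ * 'X^e ^+ (_ ^ 2)); last by case: i => i /=; lia.
    by apply: s2; case: i => i /=; lia.
  apply: eq_bigr => i _; rewrite /bump.
  congr (_ * 'X^e ^+ (_ ^ 2)); last by case: i => i /=; lia.
  by apply: s2; case: i => i /=; lia.
rewrite finite_jacobi //; last by rewrite expf_neq0 // polyX_eq0.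
rewrite mulr_sumr; apply: eqmodX_sum => k.
rewrite mulrCA -[X in eqmodX _ _ X]mulr1.
rewrite -!mulrA; apply: eqmodXMl.
have le_k : (k <= N.*2)%N by rewrite -ltnS.
have := qbinom_eqmodX R (e := e * 2) _ le_k; rewrite muln_gt0 e_gt0 => /(_ isT).
rewrite -!exprM; set d := (_ ^ 2)%N => /(@eqmodX_XnM _ _ (e * d)%N _ _).
apply: eqmodX_weaken; rewrite /d; set m := minn _ _; set D := (_ - _ + _)%N.
(* The error in term [k] has order at least [e * (D^2 + 2(m+1))], which is [e * ((D-1)^2 + 2N+1)] by
   [m + D = N], hence at least [2N+1]. *)
have DE : (m + D = N)%N by rewrite /m /D; lia.
nia.
Qed.

(** * The generating function and its product with a theta series *)

Local Open Scope classical_set_scope.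

Definition odd_ovps_poly M m : {poly int} :=
  \poly_(i < M) (size (odd_ovps m i))%:R.

Lemma odd_ovps_polyS M m :
  eqmodX M ((1 - 'X^(m.*2.+1)) * odd_ovps_poly M m.+1)
           ((1 + 'X^(m.*2.+1)) * odd_ovps_poly M m).
Proof.
move=> i iM; rewrite mulrBl mulrDl !mul1r coefB coefD !coefXnM !coef_poly iM.
rewrite size_odd_ovpsS ltnS; case: (ltnP m.*2 i) => lt_mi.
  have -> : (i - m.*2.+1 < M)%N by lia.
  by rewrite !natrD; ring.
by rewrite addn0 subr0.
Qed.

Lemma odd_ovps_poly_prod M N :
  eqmodX M ((\prod_(i < N) (1 - 'X^(i.*2.+1))) * odd_ovps_poly M N)
           (\prod_(i < N) (1 + 'X^(i.*2.+1))).
Proof.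
elim: N => [|N IHN].
  rewrite !big_ord0 mul1r => i iM; rewrite coef_poly iM coef1 /=.
  by case: i {iM}.
rewrite !big_ord_recr /= -mulrA.
refine (eqmodX_trans (eqmodXMl _ (@odd_ovps_polyS M N)) _).
rewrite mulrCA mulrC; exact: eqmodXMr.
Qed.

(** The factors of [(y; y)_(2N)] are sorted by the parity of their exponents. *)
Lemma qpoch_double (R : comNzRingType) (y : R) N :
  (\prod_(i < N) (1 - y ^+ i.*2.+1)) * qpoch (y ^+ 2) N = qpoch y N.*2.
Proof.
elim: N => [|N IHN]; first by rewrite /qpoch !big_ord0 mulr1.
rewrite big_ord_recr doubleS !qpochS -IHN /= -exprM mul2n doubleS.
by ring.
Qed.

Lemma odd_ovps_poly_theta M N : (M <= N)%N ->
  eqmodX M (odd_ovps_poly M N *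
              (1 + 2 * \sum_(j < N) (-1) ^+ j.+1 * 'X^2 ^+ (j.+1 ^ 2)))
           (1 + 2 * \sum_(j < N) 'X ^+ (j.+1 ^ 2)).
Proof.
move=> le_MN; have le_M : (M <= N.*2.+1)%N by lia.
pose A : {poly int} := \prod_(i < N) (1 - 'X^(i.*2.+1)).
pose B : {poly int} := \prod_(i < N) (1 + 'X^(i.*2.+1)).
have s1 : (-1) * (-1) = 1 :> {poly int} by rewrite mulrNN mulr1.
(* [e = 2], [s = -1] gives the alternating theta series; [e = 1], [s = 1] gives the series of
   squares. *)
have J2 := eqmodX_weaken le_M (@jacobi_eqmodX _ 2 N _ isT s1).
have J1 := eqmodX_weaken le_M
  (@jacobi_eqmodX _ 1 N _ isT (mulr1 (1 : {poly int}))).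
refine (eqmodX_trans (eqmodXMl _ (eqmodX_sym J2)) _).
have AB : \prod_(i < N) (1 + -1 * 'X^2 ^+ i.*2.+1) ^+ 2 = (A * B) ^+ 2.
  rewrite prodrXl /A /B -big_split /=; congr (_ ^+ 2); apply: eq_bigr => i _.
  by rewrite exprAC; ring.
have BB : \prod_(i < N) (1 + 1 * 'X ^+ i.*2.+1) ^+ 2 = B ^+ 2.
  by rewrite prodrXl; congr (_ ^+ 2); apply: eq_bigr => i _; rewrite mul1r.
rewrite AB.
have -> : odd_ovps_poly M N * (qpoch ('X^2 ^+ 2) N * (A * B) ^+ 2) =
   (A * odd_ovps_poly M N) * (qpoch ('X^2 ^+ 2) N * A * B ^+ 2) by ring.
refine (eqmodX_trans (eqmodXMr _ (@odd_ovps_poly_prod M N)) _).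
have -> : \prod_(i < N) (1 + 'X^(i.*2.+1)) * (qpoch ('X^2 ^+ 2) N * A * B ^+ 2) =
   (A * B * qpoch ('X^2 ^+ 2) N) * B ^+ 2 by rewrite -/B; ring.
have -> : A * B * qpoch ('X^2 ^+ 2) N = qpoch 'X^2 N.*2.
  rewrite -qpoch_double; congr (_ * _); rewrite -big_split /=.
  by apply: eq_bigr => i _; rewrite exprAC; ring.
(* The product has reached [(q^2; q^2)] with [2N] factors, while [J1] has [N]; they agree modulo
   [X^M] as [M <= N]. *)
have E : eqmodX M (qpoch ('X^2 : {poly int}) N.*2) (qpoch 'X^2 N).
  by apply: eqmodX_weaken (qpoch_eqmodX _ _ _); lia.
refine (eqmodX_trans (eqmodXMr _ E) _).
move: J1; rewrite expr1 BB.
by under eq_bigr do rewrite expr1n mul1r.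
Qed.

(** * Comparison of coefficients *)

Lemma pbar_o_neg (x : int) : x < 0 -> pbar_o x = 0.
Proof. by case: x. Qed.

Theorem theorem1p5 (n : nat) :
  pbar_o n%:Z
    + 2 * \sum_(k \in [set k : nat | (1 <= k)%N])
            ((-1) ^+ k * pbar_o (n%:Z - 2 * k%:Z ^+ 2))
  = if `[< exists m : nat, (1 <= m)%N /\ n = (m ^ 2)%N >] then 2
    else if n == 0%N then 1
    else 0 :> int.
Proof.
(* For [k > n+1] the argument [n - 2k^2] is negative, so the support is finite. *)
have -> : \sum_(k \in [set k : nat | (1 <= k)%N])
            ((-1) ^+ k * pbar_o (n%:Z - 2 * k%:Z ^+ 2)) =
   \sum_(j < n.+1) (-1) ^+ j.+1 * pbar_o (n%:Z - 2 * j.+1%:Z ^+ 2).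
  have mem_r k : [set` iota 1 n.+1] k = (0 < k <= n.+1)%N :> Prop.
    by rewrite -[LHS]/(is_true (k \in iota 1 n.+1)) mem_iota.
  rewrite -(fsbig_widen [set` iota 1 n.+1]).
  - rewrite -fsbig_seq ?iota_uniq // (iotaDl 1 0 n.+1) big_map.
    have <- := big_mkord xpredT
      (fun j => (-1) ^+ j.+1 * pbar_o (n%:Z - 2 * j.+1%:Z ^+ 2)).
    by rewrite /index_iota subn0; apply: eq_bigr => j _; rewrite add1n.
  - by move=> k; rewrite mem_r => /andP[].
  move=> k []; rewrite mem_r [X in X -> _]/= => k_gt0.
  rewrite k_gt0 /= => /negP; rewrite -ltnNge => lt_nk.
  by rewrite pbar_o_neg ?mulr0 //; nia.
(* Allowing parts below [2(n+1)] covers every overpartition of [i <= n]. *)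
have pE i : (i < n.+1)%N -> pbar_o i%:Z = (odd_ovps_poly n.+1 n.+1)`_i.
  move=> lt_i; rewrite coef_poly lt_i /= (@pbar_o_natE n.+1) ?natz //.
  by lia.
have := @odd_ovps_poly_theta n.+1 n.+1 (leqnn _) n (ltnSn _).
set f := odd_ovps_poly _ _.
rewrite mulrDr mulr1 mulrCA !mulr_natl coefD coefMn coefD coefMn coef1.
rewrite mulr_sumr !coef_sum.
under eq_bigr => j _.
  have -> : (f * ((-1) ^+ j.+1 * 'X^2 ^+ (j.+1 ^ 2)))`_n =
     (-1) ^+ j.+1 * pbar_o (n%:Z - 2 * j.+1%:Z ^+ 2).
    rewrite -exprM -polyC1 -polyCN -rmorphXn mulrCA coefCM coefMXn.
    (* A shift past degree [n] gives coefficient 0, matching the value of [pbar_o] at negative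
       arguments. *)
    congr (_ * _); case: ltnP => [lt_n|le_n]; first by rewrite pbar_o_neg //; nia.
    rewrite -pE; last by lia.
    by congr pbar_o; nia.
  over.
rewrite -(pE n) // => ->.
under eq_bigr do rewrite coefXn.
case: asboolP => [[m [m_gt0 nE]]|nsq].
  (* The index [j] stands for the square of [j.+1], so only [j = m.-1] contributes. *)
  have lt_m : (m.-1 < n.+1)%N by nia.
  rewrite (bigD1 (Ordinal lt_m)) //= prednK // -nE eqxx big1 ?addr0.
    by have -> : (n == 0)%N = false by nia.
  move=> j /eqP ne_j; case: eqP => // nE2; case: ne_j; apply: val_inj => /=.
  by nia.
rewrite big1 ?addr0; first by case: eqP.
by move=> j _; case: eqP => // nE; case: nsq; exists j.+1.
Qed.
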